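(* For every real number $d$ with $0\leq d\leq 1$, there exists a sequence $\mathbf{r}=(r_n)_{n=1}^\infty$ of positive integers with $r_n\to\infty$ as $n\to\infty$ such that both of the following hold: 1. $\dim_{\mathrm H} E_0(\mathbf{r})=\underline{\dim}_{\mathrm{MB}} E_0(\mathbf{r})=d$; 2. $\dim_{\mathrm H} E_{\mathrm f}(\mathbf{r})=\underline{\dim}_{\mathrm{MB}} E_{\mathrm f}(\mathbf{r})=d$.
   Context: For a real number $t$, $\|t\|$ denotes the distance from $t$ to the nearest integer. For a sequence $\mathbf{r}=(r_n)_{n=1}^\infty$ of positive real numbers with $r_n\to\infty$, define $$E_0(\mathbf{r})=\{x\in\mathbb{R} : r_nx\to 0 \ (\mathrm{mod}\ 1) \text{ as } n\to\infty\}=\{x\in\mathbb{R} : \|r_nx\|\to0\},$$ $$E_{\mathrm f}(\mathbf{r})=\Big\{x\in[0,1) : \sum_{n=1}^\infty\|r_nx\|<\infty\Big\}.$$ $\dim_{\mathrm H}$ denotes Hausdorff dimension. For a non-empty bounded set $F\subseteq\mathbb{R}$ and $\varepsilon>0$, let $N_\varepsilon(F)$ be the smallest number of sets of diameter at most $\varepsilon$ which can cover $F$. The lower box dimension of $F$ is $\underline{\dim}_{\mathrm B}F=\liminf_{\varepsilon\to0}\frac{\log N_\varepsilon(F)}{-\log\varepsilon}$. For $F\subseteq\mathbb{R}$, the modified lower box dimension is $$\underline{\dim}_{\mathrm{MB}}F=\inf\Big\{\sup_i\underline{\dim}_{\mathrm B}F_i : F\subseteq\bigcup_{i=1}^\infty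 F_i\Big\},$$ the infimum being over all countable covers $\{F_i\}_{i=1}^\infty$ of $F$ by non-empty bounded sets. *)

(* Defs.v *)
From HB Require Import structures.
From mathcomp Require Import all_boot all_order all_algebra.
From mathcomp Require Import all_classical all_reals all_analysis.

Set Implicit Arguments.
Unset Strict Implicit.
Unset Printing Implicit Defensive.

Import Order.TTheory GRing.Theory Num.Theory.
Import numFieldNormedType.Exports.

Local Open Scope classical_set_scope.
Local Open Scope ring_scope.

Definition dist_int (R : realType) (t : R) : R :=
  inf [set `|t - k%:~R| | k in [set: int]].

Definition E0 (R : realType) (r : nat -> R) : set R :=
  [set x | dist_int (r n * x) @[n --> \oo] --> (0 : R)].

Definition Ef (R : realType) (r : nat -> R) : set R :=
  [set x | 0 <= x < 1 /\
           (\sum_(0 <= n <oo) (dist_int (r n * x))%:E < +oo)%E].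

(* 0 is adjoined so that the diameter of the empty set is 0. *)
Definition diam (R : realType) (A : set R) : \bar R :=
  ereal_sup (0%E |` [set `|x - y|%:E | x in A & y in A]).

(* |A|^s, with |set0|^s = 0 for every s, and |A|^0 = 1 for A nonempty. *)
Definition diam_pow (R : realType) (s : R) (A : set R) : \bar R :=
  if A == set0 then 0%E else poweR (diam A) s.

Definition hausdorff_premeasure (R : realType) (s delta : R) (A : set R)
    : \bar R :=
  ereal_inf [set (\sum_(0 <= i <oo) diam_pow s (U i))%E
            | U in [set U : nat -> set R |
                     (forall i, (diam (U i) <= delta%:E)%E) /\
                     A `<=` \bigcup_i U i]].

(* The premeasure is nonincreasing in delta, so this supremum is its limit as
   delta tends to 0. *)
Definition hausdorff_measure (R : realType) (s : R) (A : set R) : \bar R :=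
  ereal_sup [set hausdorff_premeasure s delta A
            | delta in [set delta : R | 0 < delta]].

Definition hausdorff_dim (R : realType) (A : set R) : \bar R :=
  ereal_inf [set s%:E | s in [set s : R | 0 <= s /\
                                          hausdorff_measure s A = 0%E]].

Definition coverable (R : realType) (eps : R) (F : set R) (n : nat) : Prop :=
  exists U : 'I_n -> set R,
    (forall i, (diam (U i) <= eps%:E)%E) /\
    F `<=` [set x | exists i, U i x].

(* For bounded F and eps > 0 the least n exists; the default value 0 is only
   taken when F has no finite cover of this kind. *)
Definition cover_number (R : realType) (eps : R) (F : set R) : nat :=
  xget 0%N [set n | coverable eps F n /\
                    forall m, coverable eps F m -> (n <= m)%N].

Definition lower_box_dim (R : realType) (F : set R) : \bar R :=
  limf_einf
    (fun eps : R => (ln ((cover_number eps F)%:R : R) / - ln eps)%:E) 0^'+.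

Definition lower_modified_box_dim (R : realType) (F : set R) : \bar R :=
  ereal_inf [set ereal_sup (range (fun i => lower_box_dim (Fi i)))
            | Fi in [set Fi : nat -> set R |
                      (forall i, Fi i !=set0 /\ bounded_set (Fi i)) /\
                      F `<=` \bigcup_i Fi i]].

(* Main.v *)
Require Import Defs.
From mathcomp Require Import all_boot all_order all_algebra.
From mathcomp Require Import all_classical all_reals all_analysis.
From mathcomp Require Import ring lra zify.
From Stdlib Require PeanoNat.
Set Implicit Arguments.
Unset Strict Implicit.
Unset Printing Implicit Defensive.

Import Order.TTheory GRing.Theory Num.Theory.
Import numFieldNormedType.Exports.
Local Open Scope classical_set_scope.
Local Open Scope ring_scope.

(** Take r_n = 2^(s_n), where s_n runs over a set of binary positions. If 2^m x
    is close to an integer for all m in a run of consecutive positions, the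
    binary digits of x are constant along that run, so membership of x in the
    set E_0 freezes the digits at the positions used and leaves the others free.
    Hence the dimension should be the density of the unused positions, and that
    density can be any d in [0,1].

    Concretely, cut the positions into the blocks [j^2, (j+1)^2). The block
    number j has 2j+1 positions; its last u_j = floor(d(2j+1)) positions are
    free, and s_n is n, capped at the start of the free part of the block of n
    ([capped_exponent]). Two features of square blocks matter: the number of
    blocks before position N is about sqrt N, so a bounded or logarithmic loss
    per block does not affect the dimension; and the blocks are short compared
    with their position, so it suffices to look at the scales 2^-(j^2).

    All four dimensions are pinned by the chain
      d <= dim_H E_f <= dim_H E_0 <= dim_MB E_0 <= d
    together with dim_H E_f <= dim_MB E_f <= dim_MB E_0. Besides monotonicity
    and the inclusion of E_f in E_0, this needs three facts.

    - dim_H <= dim_MB for every set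
      ([hausdorff_dim_le_lower_modified_box_dim]): a small lower box dimension
      of a piece gives efficient covers of it at some arbitrarily small scale,
      and such covers of countably many pieces can be added up.

    - dim_MB E_0 <= d ([lower_modified_box_dim_E0]): E_0 is the union over J of
      the bounded sets where |x| <= J and the distances are below 1/8 from J on.
      On such a set, passing from scale 2^-(j^2) to 2^-((j+1)^2) multiplies the
      number of candidate intervals by at most 2^(u_j + 1)
      ([near_int_codes]), and the exponents add up to at most d j^2 + j.

    - dim_H E_f >= d ([hausdorff_dim_Ef_ge]): write the digits of a parameter
      a in [0,1) into the free positions, except for the first
      k_j = O(log j) of them in each block, where zeros are kept as a guard so
      that the distances become summable ([block_insert_Ef]). The inverse of
      this map is Hoelder of every exponent s < d, so a cover of E_f with small
      s-dimensional sum would give a cover of [0,1) of small length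
      ([hausdorff_measure_neq0]). *)
(** * Diameters, Hausdorff measure and covering numbers *)

Lemma diam_ge0 (R : realType) (A : set R) : (0 <= diam A)%E.
Proof. by apply: ereal_sup_ubound; left. Qed.

Lemma diam0 (R : realType) : diam (@set0 R) = 0%E.
Proof.
apply/eqP; rewrite eq_le diam_ge0 andbT.
by apply: ge_ereal_sup => _ /= [->|[x []]].
Qed.

Lemma diam_le (R : realType) (A : set R) (e : R) : 0 <= e ->
  (forall x y, A x -> A y -> `|x - y| <= e) -> (diam A <= e%:E)%E.
Proof.
move=> e0 Ae; apply: ge_ereal_sup => _ /= [->|[x Ax [y Ay <-]]].
  by rewrite lee_fin.
by rewrite lee_fin Ae.
Qed.

Lemma le_diam (R : realType) (A : set R) x y :
  A x -> A y -> (`|x - y|%:E <= diam A)%E.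
Proof.
by move=> Ax Ay; apply: ereal_sup_ubound; right; exists x => //; exists y.
Qed.

Lemma diam_pow0 (R : realType) (s : R) : diam_pow s set0 = 0%E.
Proof. by rewrite /diam_pow eqxx. Qed.

Lemma diam_pow_ge0 (R : realType) (s : R) (A : set R) : (0 <= diam_pow s A)%E.
Proof. by rewrite /diam_pow; case: ifP => // _; exact: poweR_ge0. Qed.

Lemma diam_pow_le (R : realType) (s e : R) (A : set R) :
  0 <= s -> 0 <= e -> (diam A <= e%:E)%E -> (diam_pow s A <= (e `^ s)%:E)%E.
Proof.
move=> s0 e0 Ae; rewrite /diam_pow; case: ifP => _.
  by rewrite lee_fin powR_ge0.
rewrite -poweR_EFin; apply: gt0_ler_poweR => //.
  by rewrite in_itv /= leey andbT diam_ge0.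
by rewrite in_itv /= leey andbT lee_fin.
Qed.

Lemma hausdorff_premeasure_ge0 (R : realType) (s delta : R) (A : set R) :
  (0 <= hausdorff_premeasure s delta A)%E.
Proof.
apply: le_ereal_inf_tmp => _ [U _ <-].
by apply: nneseries_ge0 => n _ _; exact: diam_pow_ge0.
Qed.

Lemma hausdorff_measure_ge0 (R : realType) (s : R) (A : set R) :
  (0 <= hausdorff_measure s A)%E.
Proof.
apply: le_trans (hausdorff_premeasure_ge0 s 1 A) _.
by apply: ereal_sup_ubound; exists 1 => //=.
Qed.

Lemma hausdorff_dim_ge0 (R : realType) (A : set R) : (0 <= hausdorff_dim A)%E.
Proof. by apply: le_ereal_inf_tmp => _ [s [s0 _] <-]; rewrite lee_fin. Qed.

Lemma hausdorff_measureS (R : realType) (s : R) (A B : set R) :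
  A `<=` B -> (hausdorff_measure s A <= hausdorff_measure s B)%E.
Proof.
move=> AB; apply: ge_ereal_sup => _ [e e0 <-].
apply: (@le_trans _ _ (hausdorff_premeasure s e B)).
  apply: ereal_inf_le_tmp => _ [U [Ue BU] <-].
  by exists U => //; split => //; exact: subset_trans BU.
by apply: ereal_sup_ubound; exists e.
Qed.

Lemma hausdorff_dimS (R : realType) (A B : set R) :
  A `<=` B -> (hausdorff_dim A <= hausdorff_dim B)%E.
Proof.
move=> AB; apply: ereal_inf_le_tmp => _ [s [s0 sB] <-]; exists s => //; split => //.
by apply/eqP; rewrite eq_le hausdorff_measure_ge0 andbT -sB hausdorff_measureS.
Qed.

Lemma lower_modified_box_dimS (R : realType) (A B : set R) :
  A `<=` B -> (lower_modified_box_dim A <= lower_modified_box_dim B)%E.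
Proof.
move=> AB; apply: ereal_inf_le_tmp => _ [F [Fb BF] <-]; exists F => //; split => //.
exact: subset_trans BF.
Qed.

(** The number chosen by [cover_number] is a genuine minimum as soon as one
    finite cover exists, by well-ordering of the naturals. *)
Lemma coverable_cover_number (R : realType) (e : R) (F : set R) n :
  coverable e F n ->
  coverable e F (cover_number e F) /\ (cover_number e F <= n)%N.
Proof.
move=> Fn.
have ex : exists m, (fun m => `[< coverable e F m >]) m by exists n; apply/asboolP.
have [m /asboolP Fm mmin] := ex_minnP ex.
rewrite /cover_number; case: xgetP => [k _ [Fk kmin]|/(_ m)]; last first.
  by case; split => // k Fk; apply: mmin; apply/asboolP.
by split => //; exact: kmin.
Qed.

Lemma bounded_coverable (R : realType) (e : R) (F : set R) :
  bounded_set F -> 0 < e -> exists n, coverable e F n.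
Proof.
move=> bF e0.
have [B B0 FB] : exists2 B : R, 0 < B & forall x, F x -> `|x| <= B.
  by have [B B0 FB] := pinfty_ex_gt0 bF; exists B.
exists (Num.truncn (2 * B / e)).+1.
exists (fun i => [set x | i%:R * e <= x + B <= i.+1%:R * e]); split.
  move=> i; apply: diam_le => [|x y /= /andP[x1 x2] /andP[y1 y2]]; first exact: ltW.
  move: (nat_of_ord i) x1 x2 y1 y2 => k; rewrite -natr1 mulrDl mul1r => x1 x2 y1 y2.
  by rewrite ler_norml; apply/andP; split; lra.
move=> x Fx /=.
have /andP[xB1 xB2] : - B <= x <= B by rewrite -ler_norml FB.
have h0 : 0 <= (x + B) / e by apply: divr_ge0; [lra|exact: ltW].
have lt : (Num.truncn ((x + B) / e) < (Num.truncn (2 * B / e)).+1)%N.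
  by rewrite ltnS; apply: le_truncn; rewrite ler_pM2r ?invr_gt0//; lra.
exists (Ordinal lt) => /=; have /andP[] := truncn_itv h0.
by rewrite ler_pdivlMr// ltr_pdivrMr// => -> /ltW ->.
Qed.

Lemma nbhs_right0_itv (R : realType) (m : R) : 0 < m ->
  nbhs (0 : R)^'+ `]0, m[%classic.
Proof.
move=> m0; near=> x; rewrite /= in_itv /=; apply/andP; split; near: x.
  exact: nbhs_right_gt.
exact: nbhs_right_lt.
Unshelve. all: by end_near. Qed.

(** A lower limit below s only says that good scales occur arbitrarily close to
    0; this extracts one of them together with its cover. *)
Lemma lower_box_dim_lt_covers (R : realType) (s delta : R) (F : set R) :
  bounded_set F -> 0 < delta -> (lower_box_dim F < s%:E)%E ->
  exists e n, [/\ 0 < e < delta, e < 1, coverable e F n &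
    ln (n%:R : R) < s * - ln e].
Proof.
move=> bF d0; rewrite /lower_box_dim limf_einfE => Fs.
set m : R := Num.min delta 1.
have m0 : 0 < m by rewrite lt_min d0 ltr01.
have : (ereal_inf
    [set ((ln ((cover_number eps F)%:R : R) / - ln eps)%:E : \bar R)
    | eps in `]0%R, m[%classic] < s%:E)%E.
  apply: le_lt_trans Fs; apply: ereal_sup_ubound; exists `]0, m[%classic => //.
  exact: nbhs_right0_itv.
move=> /ereal_inf_lt[_ [e /= + <-]]; rewrite in_itv /= lt_min => /andP[e0 /andP[ed e1]].
rewrite lte_fin ltr_pdivrMr; last by rewrite oppr_gt0 ln_lt0// e0.
move=> h; exists e, (cover_number e F); split => //; first by rewrite e0.
by have [n Fn] := bounded_coverable bF e0; have [] := coverable_cover_number Fn.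
Qed.

Lemma lower_box_dim_ge0 (R : realType) (F : set R) : (0 <= lower_box_dim F)%E.
Proof.
rewrite /lower_box_dim limf_einfE.
apply: (@le_trans _ _ (ereal_inf
    [set ((ln ((cover_number eps F)%:R : R) / - ln eps)%:E : \bar R)
    | eps in `]0%R, 1[%classic])).
  apply: le_ereal_inf_tmp => _ [e /= + <-]; rewrite in_itv /= => /andP[e0 e1].
  rewrite lee_fin divr_ge0//; last by rewrite oppr_ge0 ln_le0// ltW.
  by case: cover_number => [|n]; [rewrite ln0|rewrite ln_ge0// ler1n].
apply: ereal_sup_ubound; exists `]0, 1[%classic => //.
exact: nbhs_right0_itv.
Qed.

(** Dually, efficient covers along some sequence of scales tending to 0 are
    enough to bound the lower box dimension. *)
Lemma lower_box_dim_le (R : realType) (s : R) (F : set R) :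
  (forall eta, 0 < eta -> exists e n,
     [/\ 0 < e < eta, e < 1, coverable e F n, (0 < n)%N &
     ln (n%:R : R) <= (s + eta) * - ln e]) ->
  (lower_box_dim F <= s%:E)%E.
Proof.
move=> H; rewrite /lower_box_dim limf_einfE; apply: ge_ereal_sup => _ [A A0 <-].
have [e0 /= e00 Ae] : exists2 e0 : R, 0 < e0 & forall e, 0 < e < e0 -> A e.
  case: A0 => /= e0 e00 Ae; exists e0 => // e /andP[ep ee0].
  by apply: Ae => //=; rewrite sub0r normrN gtr0_norm.
apply/lee_addgt0Pr => x x0.
have [|e [n [/andP[ep]]]] := H (Num.min e0 x); first by rewrite lt_min e00.
rewrite lt_min => /andP[ee0 ex] e1 Fn n0 ln_n.
apply: (@le_trans _ _ ((ln ((cover_number e F)%:R : R) / - ln e)%:E)).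
  by apply: ereal_inf_lbound; exists e => //; apply: Ae; rewrite ep.
have ln0e : 0 < - ln e by rewrite oppr_gt0 ln_lt0// ep.
rewrite -EFinD lee_fin ler_pdivrMr//.
have [_ len] := coverable_cover_number Fn.
apply: (@le_trans _ _ (ln (n%:R : R))).
  case: cover_number len => [|k] len; first by rewrite ln0// ln_ge0// ler1n.
  by rewrite ler_ln ?posrE ?ltr0n// ler_nat.
apply: le_trans ln_n _; apply: ler_wpM2r; first exact: ltW.
by rewrite lerD2l ge_min lexx orbT.
Qed.

(** * Hausdorff dimension is at most the modified lower box dimension *)

(** Covers with sums below eta / 2^(i+1) for the i-th set are merged into one
    cover indexed by pairs, hence by naturals, with sum at most eta. *)
Lemma hausdorff_premeasure_null_bigcup (R : realType) (s delta : R)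
    (F : nat -> set R) :
  (forall i, hausdorff_premeasure s delta (F i) = 0%E) ->
  hausdorff_premeasure s delta (\bigcup_i F i) = 0%E.
Proof.
move=> F0; apply/eqP; rewrite eq_le hausdorff_premeasure_ge0 andbT.
apply/lee_addgt0Pr => eta eta0; rewrite add0e.
have /choice[V VP] i : exists V : nat -> set R,
    [/\ forall j, (diam (V j) <= delta%:E)%E, F i `<=` \bigcup_j V j &
     (\sum_(0 <= j <oo) diam_pow s (V j) <= (eta / (2 ^ i.+1)%:R)%:E)%E].
  have : (hausdorff_premeasure s delta (F i) < (eta / (2 ^ i.+1)%:R)%:E)%E.
    by rewrite F0 lte_fin divr_gt0// ltr0n expn_gt0.
  by move=> /ereal_inf_lt[_ [V [Vd FV] <-] /ltW lt]; exists V.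
have /card_esym/ppcard_eqP[f] := card_nat2.
apply: (@le_trans _ _ (\sum_(0 <= k <oo) diam_pow s (V (f k).1 (f k).2))%E).
  apply: ereal_inf_lbound; exists (fun k => V (f k).1 (f k).2) => //; split.
    by move=> k; have [] := VP (f k).1.
  move=> x [i _ Fx]; have [_ /(_ _ Fx)[j _ Vx] _] := VP i.
  by exists (f^-1%FUN (i, j)) => //; rewrite invK ?inE.
have dge k : (0 <= diam_pow s (V k.1 k.2))%E by exact: diam_pow_ge0.
rewrite nneseries_esumT; last by move=> k; exact: (dge (f k)).
have bijf : set_bij setT setT f by exact: bij.
rewrite -(reindex_esum _ _ f (fun k => diam_pow s (V k.1 k.2)) bijf).
have -> : [set: nat * nat] = [set: nat] `*`` (fun=> [set: nat]).
  by apply/seteqP; split.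
rewrite -(@esum_esum _ _ _ _ _ (fun i j => diam_pow s (V i j))); last first.
  by move=> *; exact: diam_pow_ge0.
under eq_esum => i _.
  rewrite -nneseries_esumT; last by move=> j; exact: diam_pow_ge0.
  over.
rewrite -nneseries_esumT; last first.
  by move=> i; apply: nneseries_ge0 => *; exact: diam_pow_ge0.
apply: le_trans (epsilon_trick0 xpredT (ltW eta0)).
apply: lee_nneseries => [i _ _|i _]; first by apply: nneseries_ge0 => *; exact: diam_pow_ge0.
by have [] := VP i.
Qed.

Lemma hausdorff_premeasure_coverable (R : realType) (s delta e : R)
    (F : set R) n :
  0 <= s -> 0 <= e <= delta -> coverable e F n ->
  (hausdorff_premeasure s delta F <= (n%:R * e `^ s)%:E)%E.
Proof.
move=> s0 /andP[e0 ed] [U [Ue FU]].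
pose V j := if insub j is Some i then U i else set0 : set R.
have Ve j : (diam (V j) <= e%:E)%E.
  by rewrite /V; case: insubP => [i _ _|_] //; rewrite diam0 lee_fin.
apply: (@le_trans _ _ (\sum_(0 <= j <oo) diam_pow s (V j))%E).
  apply: ereal_inf_lbound; exists V => //; split.
    by move=> j; apply: le_trans (Ve j) _; rewrite lee_fin.
  by move=> x /FU[i Ux]; exists (i : nat) => //; rewrite /V valK.
rewrite (nneseries_split 0 n); last by move=> *; exact: diam_pow_ge0.
rewrite [X in (_ + X)%E]eseries0 ?adde0; last first.
  move=> j; rewrite add0n => nj _; rewrite /V insubF ?diam_pow0//.
  by apply/negbTE; rewrite -leqNgt.
rewrite add0n; apply: (@le_trans _ _ (\sum_(0 <= j < n) (e `^ s)%:E)%E).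
  by apply: lee_sum => j _; exact: diam_pow_le.
by rewrite sumEFin sumr_const_nat subn0 mulr_natl.
Qed.

(** If F is covered by n <= e^-s sets of diameter e, then
    n e^t <= e^(t-s), which is as small as desired because e can be chosen
    after the target eta. *)
Lemma hausdorff_premeasure_box_null (R : realType) (s t delta : R) (F : set R) :
  bounded_set F -> 0 <= s -> s < t -> 0 < delta -> (lower_box_dim F < s%:E)%E ->
  hausdorff_premeasure t delta F = 0%E.
Proof.
move=> bF s0 st delta0 Fs; apply/eqP; rewrite eq_le hausdorff_premeasure_ge0 andbT.
apply/lee_addgt0Pr => eta eta0; rewrite add0e.
have ts : 0 < t - s by lra.
(* the second bound on the scale is what makes e^(t-s) at most eta *)
pose m := Num.min delta (eta `^ (t - s)^-1).
have m0 : 0 < m by rewrite lt_min delta0 powR_gt0.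
have [e [n [/andP[e0]]]] := lower_box_dim_lt_covers bF m0 Fs.
rewrite lt_min => /andP[ed ee] e1 Fn ln_n.
apply: le_trans (hausdorff_premeasure_coverable _ _ Fn) _; first by lra.
  by rewrite !ltW.
rewrite lee_fin; apply: (@le_trans _ _ (e `^ (t - s))).
  have -> : e `^ t = e `^ s * e `^ (t - s).
    by rewrite -powRD ?(gt_eqF e0) ?implybT// addrC subrK.
  rewrite mulrA ler_piMl ?powR_ge0//.
  case: n ln_n {Fn} => [|n] ln_n; first by rewrite mul0r.
  have : ln (n.+1%:R * e `^ s) <= 0.
    by rewrite lnM ?posrE ?ltr0n ?powR_gt0// ln_powR; lra.
  by rewrite -ln1 ler_ln // posrE ?mulr_gt0 ?powR_gt0.
have -> : eta = (eta `^ (t - s)^-1) `^ (t - s).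
  by rewrite -powRrM mulVf ?powRr1 ?(ltW eta0)// gt_eqF.
apply: ge0_ler_powR; rewrite ?nnegrE ?powR_ge0 //; exact: ltW.
Qed.

Lemma hausdorff_dim_le_lower_modified_box_dim (R : realType) (F : set R) :
  (hausdorff_dim F <= lower_modified_box_dim F)%E.
Proof.
apply: le_ereal_inf_tmp => _ [Fi [Fib FFi] <-].
set S := ereal_sup _.
have leS i : (lower_box_dim (Fi i) <= S)%E by apply: ereal_sup_ubound; exists i.
have S0 : (0 <= S)%E by apply: le_trans (leS 0%N); apply: lower_box_dim_ge0.
apply/lee_addgt0Pr => x x0.
clearbody S; case: S S0 leS => [S S0 leS|_ _|//]; last by rewrite addye // leey.
apply: ereal_inf_lbound; exists (S + x) => //; rewrite lee_fin in S0; split; first lra.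
apply/eqP; rewrite eq_le hausdorff_measure_ge0 andbT.
apply: ge_ereal_sup => _ [delta /= delta0 <-].
have -> : 0%E = hausdorff_premeasure (S + x) delta (\bigcup_i Fi i).
  rewrite hausdorff_premeasure_null_bigcup// => i.
  have [_ bFi] := Fib i.
  apply: (hausdorff_premeasure_box_null bFi (s := S + x / 2)) => //; [lra|lra|].
  by apply: le_lt_trans (leS i) _; rewrite lte_fin; lra.
apply: ereal_inf_le_tmp => _ [U [Ud FU] <-]; exists U => //; split => //.
exact: subset_trans FU.
Qed.

(** * Distance to the nearest integer *)

Lemma dist_int_has_inf (R : realType) (t : R) :
  has_inf [set `|t - k%:~R| | k in [set: int]].
Proof.
by split; [exists `|t - 0%:~R|; exists 0|exists 0 => _ [k _ <-]; exact: normr_ge0].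
Qed.

Lemma dist_int_ge0 (R : realType) (t : R) : 0 <= dist_int t.
Proof.
by apply: lb_le_inf => [|_ [k _ <-] //]; have [] := dist_int_has_inf t.
Qed.

Lemma dist_int_le (R : realType) (t : R) (k : int) : dist_int t <= `|t - k%:~R|.
Proof. by apply: ge_inf; [have [] := dist_int_has_inf t|exists k]. Qed.

Lemma dist_int_lt (R : realType) (t e : R) :
  dist_int t < e -> exists k : int, `|t - k%:~R| < e.
Proof.
move=> te; have te0 : 0 < e - dist_int t by rewrite subr_gt0.
have [_ [k _ <-]] := inf_adherent te0 (dist_int_has_inf t).
by rewrite -/(dist_int t) => h; exists k; lra.
Qed.

Lemma Ef_sub_E0 (R : realType) (r : nat -> R) : Ef r `<=` E0 r.
Proof.
move=> x [_ fin]; apply/cvg_series_cvg_0/nnseries_is_cvg => // n.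
exact: dist_int_ge0.
Qed.

(** * The sequence and its upper dimension bound *)

(** Within the block [j^2, (j+1)^2) the exponent follows n up to the start
    (j+1)^2 - u_j of the free positions and then stays there. Repeating the last
    exponent avoids enumerating the used positions, at the price of a factor
    2j+1 per block in the sum of the distances. *)
Definition capped_exponent (u : nat -> nat) (n : nat) : nat :=
  minn n ((Nat.sqrt n).+1 ^ 2 - u (Nat.sqrt n)).

Lemma sqrt_itv n : (Nat.sqrt n ^ 2 <= n < (Nat.sqrt n).+1 ^ 2)%N.
Proof. by have := PeanoNat.Nat.sqrt_spec n; rewrite -!mulnn; lia. Qed.

Lemma sqrt_block j n : (j ^ 2 <= n < j.+1 ^ 2)%N -> Nat.sqrt n = j.
Proof. by rewrite -!mulnn => h; apply: PeanoNat.Nat.sqrt_unique; lia. Qed.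

Lemma capped_exponent_ge u n : (forall j, u j <= j.*2.+1)%N ->
  (Nat.sqrt n ^ 2 <= capped_exponent u n)%N.
Proof.
move=> /(_ (Nat.sqrt n)); have := sqrt_itv n; rewrite /capped_exponent.
by rewrite -!mulnn; nia.
Qed.

Lemma capped_exponent_id u j n : (forall j, u j <= j.*2.+1)%N ->
  (j ^ 2 <= n <= j.+1 ^ 2 - u j)%N -> capped_exponent u n = n.
Proof.
move=> hu /andP[jn nj]; have [ltn|gen] := ltnP n (j.+1 ^ 2).
  have sj : Nat.sqrt n = j by apply: sqrt_block; rewrite jn.
  by rewrite /capped_exponent sj; lia.
have nE : n = (j.+1 ^ 2)%N by lia.
have sj : Nat.sqrt n = j.+1 by apply: sqrt_block; rewrite nE leqnn /= -!mulnn; lia.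
rewrite /capped_exponent sj nE; have := hu j.+1; rewrite -!mulnn; lia.
Qed.

Lemma capped_power_cvg (R : realType) u : (forall j, u j <= j.*2.+1)%N ->
  ((2 ^ capped_exponent u n)%N%:R : R) @[n --> \oo] --> +oo.
Proof.
move=> hu; apply/cvgryPge => A; exists ((Num.truncn A).+1 ^ 2)%N => //= n nA.
apply/ltW/(lt_le_trans (truncnS_gt A)); rewrite ler_nat.
apply: leq_trans (ltnW (ltn_expl (capped_exponent u n) (isT : 1 < 2)%N)).
apply: leq_trans (capped_exponent_ge n hu).
have : ((Num.truncn A).+1 < (Nat.sqrt n).+1)%N.
  by have /andP[_ ] := sqrt_itv n => /(leq_ltn_trans nA); rewrite ltn_sqr.
rewrite ltnS -mulnn; case: (Nat.sqrt n) => // s h.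
by apply: leq_trans h _; rewrite leq_pmulr.
Qed.

(** A bounded piece of E_0. The threshold 1/8 is small enough for nearest
    integers to double exactly from one position to the next. *)
Definition eventually_near_int (R : realType) (u : nat -> nat) (J : nat) :
    set R :=
  [set x | `|x| <= J%:R /\
    forall n, (J <= n)%N -> dist_int (2 ^+ capped_exponent u n * x) < 8^-1].

Lemma E0_sub_near_int (R : realType) u :
  E0 (fun n => (2 ^ capped_exponent u n)%N%:R : R) `<=`
  \bigcup_J eventually_near_int u J.
Proof.
move=> x /cvgrPdist_lt /(_ 8^-1) [|N _ HN]; first by rewrite invr_gt0.
exists (maxn N (Num.truncn `|x|).+1) => //; split.
  by apply/ltW/(lt_le_trans (truncnS_gt _)); rewrite ler_nat leq_maxr.
move=> n; rewrite geq_max => /andP[Nn _].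
by have := HN n Nn; rewrite /= sub0r normrN ger0_norm ?dist_int_ge0 // natrX.
Qed.

(** Along the used part of block j the nearest integer to 2^m x doubles at each
    step: 2q is within 1/4 of 2^(m+1) x and the nearest integer is within 1/8,
    so the two integers are less than 1 apart. This is the rigidity of the
    binary digits along a run. *)
Lemma near_int_run (R : realType) u J j (x : R) (p : int) :
  (forall j, u j <= j.*2.+1)%N -> (J <= j)%N -> eventually_near_int u J x ->
  `|2 ^+ (j ^ 2) * x - p%:~R| < 8^-1 ->
  forall i, (j ^ 2 + i <= j.+1 ^ 2 - u j)%N ->
  `|2 ^+ (j ^ 2 + i) * x - 2 ^+ i * p%:~R| < 8^-1.
Proof.
move=> hu Jj [_ Ax] xp; elim=> [|i IH] hi; first by rewrite addn0 expr0 mul1r.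
have {}IH := IH (ltac:(lia)).
have [|q hq] := @dist_int_lt _ (2 ^+ (j ^ 2 + i.+1) * x) 8^-1.
  rewrite -[X in 2 ^+ X](capped_exponent_id (j := j) hu); last by rewrite hi; lia.
  by apply: Ax; rewrite -!mulnn; nia.
suff qE : q = 2 ^+ i.+1 * p.
  by move: hq; rewrite qE rmorphM rmorphXn.
have : `|((q - 2 ^+ i.+1 * p)%:~R : R)| < 1.
  rewrite rmorphB rmorphM rmorphXn /=.
  move: hq IH; rewrite addnS !exprS -!mulrA.
  move: (2 ^+ (j ^ 2 + i) * x) (2 ^+ i * p%:~R) (q%:~R) => a b c.
  by rewrite !ltr_norml => /andP[h1 h2] /andP[h3 h4]; apply/andP; split; lra.
by rewrite -intr_norm -[1]/(1%:~R) ltr_int => h; lia.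
Qed.

(** Counting: the nearest integer at the start of block j + 1 is determined by
    the one at the start of block j, up to an error coming only from the u_j free
    doublings. That error is below 2^u/8 + 1/8, hence in [-2^u, 2^u), which
    leaves 2^(u+1) choices. The constant C counts the choices at the first
    block, bounded because |x| <= J. *)
Lemma near_int_codes (R : realType) u J : (forall j, u j <= j.*2.+1)%N ->
  exists2 C, (0 < C)%N & forall j, (J <= j)%N -> exists L : seq int,
    (size L <= C * 2 ^ (\sum_(i < j) (u i).+1))%N /\
    forall x : R, eventually_near_int u J x ->
      exists2 p, p \in L & `|2 ^+ (j ^ 2) * x - p%:~R| < 8^-1.
Proof.
move=> hu; pose K := (J * 2 ^ (J ^ 2)).+1; exists K.*2.+1 => //.
have near_sq j (x : R) : (J <= j)%N -> eventually_near_int u J x ->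
    exists p : int, `|2 ^+ (j ^ 2) * x - p%:~R| < 8^-1.
  move=> Jj [_ Ax]; apply: dist_int_lt.
  rewrite -[X in 2 ^+ X](capped_exponent_id (j := j) hu); last first.
    by have := hu j; rewrite -!mulnn; lia.
  by apply: Ax; rewrite -!mulnn; nia.
have base : exists L : seq int, (size L <= K.*2.+1)%N /\
    forall x : R, eventually_near_int u J x ->
      exists2 p, p \in L & `|2 ^+ (J ^ 2) * x - p%:~R| < 8^-1.
  exists [seq k%:Z - K%:Z | k <- iota 0 K.*2.+1]; split.
    by rewrite size_map size_iota.
  move=> x Ax; have [p hp] := near_sq J x (leqnn J) Ax; exists p => //.
  have pK : `|p| < K%:Z.
    rewrite -(ltr_int R) intr_norm -pmulrn /K -natr1 natrM natrX.
    have [xJ _] := Ax; have h2 : (0:R) < 2 ^+ (J ^ 2) by rewrite exprn_gt0.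
    have : `|2 ^+ (J ^ 2) * x| <= J%:R * 2 ^+ (J ^ 2).
      by rewrite normrM gtr0_norm // mulrC ler_pM2r.
    move: hp; move: (2 ^+ _ * x) (J%:R * _) => a b.
    have := ler_distD a 0 (p%:~R : R); rewrite !sub0r !normrN; lra.
  apply/mapP; exists (absz (p + K%:Z)); last by lia.
  by rewrite mem_iota; lia.
elim=> [|j IH] Jj.
  move: Jj base; rewrite leqn0 => /eqP -> [L [sL HL]].
  by exists L; rewrite big_ord0 expn0 muln1.
move: Jj; rewrite leq_eqVlt => /orP[/eqP <-|Jj].
  have [L [sL HL]] := base; exists L; split=> //.
  by apply: leq_trans sL _; rewrite leq_pmulr // expn_gt0.
have {IH}[L [sL HL]] := IH Jj.
(* the possible corrections, shifted so as to start at -2^u *)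
pose L' := [seq k%:Z - (2 ^ u j)%N%:Z | k <- iota 0 (2 ^ (u j).+1)].
exists [seq 2 ^+ (j.*2.+1) * p + e | p <- L, e <- L']; split.
  rewrite size_allpairs size_map size_iota big_ord_recr /= expnD mulnA.
  by rewrite leq_mul2r sL orbT.
move=> x Ax; have [p pL hp] := HL x Ax.
have := @near_int_run _ u J j x p hu Jj Ax hp (j.*2.+1 - u j)%N.
have uj := hu j.
have -> : (j ^ 2 + (j.*2.+1 - u j) = j.+1 ^ 2 - u j)%N by rewrite -!mulnn; lia.
move=> /(_ (leqnn _)) hq.
have [q hq'] := near_sq j.+1 x (leqW Jj) Ax.
have pe : `|q - 2 ^+ j.*2.+1 * p| < (2 ^ u j)%N%:Z.
  rewrite -(ltr_int R) intr_norm rmorphB rmorphM rmorphXn /= -pmulrn natrX.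
  move: hq hq'.
  have -> : (j.+1 ^ 2 = u j + (j.+1 ^ 2 - u j))%N by rewrite -!mulnn; lia.
  rewrite addKn -[X in (2%:~R ^+ X)](subnKC uj) !exprD -!mulrA.
  have : (1:R) <= 2 ^+ u j by rewrite exprn_ege1 // ler1n.
  rewrite (_ : 2%:~R = 2 :> R) //.
  move: (2 ^+ (j.+1 ^ 2 - u j) * x) (2 ^+ (j.*2.+1 - u j) * p%:~R).
  move: (2 ^+ u j) (q%:~R) => c d a b c1.
  rewrite !ltr_norml => /andP[h1 h2] /andP[h3 h4]; apply/andP; split; nra.
exists q => //; apply/allpairsP; exists (p, q - 2 ^+ j.*2.+1 * p) => /=; split => //.
  apply/mapP; exists (absz (q - 2 ^+ j.*2.+1 * p + (2 ^ u j)%N%:Z)).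
    by rewrite mem_iota expnS; lia.
  by lia.
by rewrite addrC subrK.
Qed.

(** At scale 2^-(j^2) the covering number is at most
    C 2^(d j^2 + j), so the quotient of logarithms is at most
    d + (ln C / ln 2 + 1) / j. *)
Lemma lower_box_dim_near_int (R : realType) (d : R) u J :
  (forall j, u j <= j.*2.+1)%N -> (forall j, (u j)%:R <= d * j.*2.+1%:R) ->
  (lower_box_dim (eventually_near_int u J : set R) <= d%:E)%E.
Proof.
move=> hu ud; have [C C0 HC] := near_int_codes R J hu.
apply: lower_box_dim_le => eta eta0.
have ln2 : 0 < ln (2 : R) by rewrite ln_gt0 // ltr1n.
have lnC : 0 <= ln (C%:R : R) by rewrite ln_ge0 // ler1n.
pose a := eta^-1; pose b := (ln (C%:R : R) / ln 2 + 1) / eta.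
have a0 : 0 < a by rewrite invr_gt0.
have b0 : 0 < b by rewrite divr_gt0 // ltr_wpDl // divr_ge0 // ltW.
have [j [Jj ja jb j0]] : exists j : nat,
    [/\ (J <= j)%N, a < j%:R, b < j%:R & (0 < j)%N].
  exists (J + (Num.truncn a).+1 + (Num.truncn b).+1)%N.
  split; [by rewrite -addnA leq_addr| | |by rewrite addnS].
    apply: lt_le_trans (truncnS_gt a) _; rewrite ler_nat.
    by move: (Num.truncn a) (Num.truncn b) => *; lia.
  apply: lt_le_trans (truncnS_gt b) _; rewrite ler_nat.
  by move: (Num.truncn a) (Num.truncn b) => *; lia.
have [L [sL HL]] := HC j Jj.
have sumu m : \sum_(i < m) (u i).+1%:R <= d * (m ^ 2)%:R + m%:R :> R.
  elim: m => [|m IH]; first by rewrite big_ord0 mulr0 addr0.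
  rewrite big_ord_recr /=; have := ud m.
  have -> : (m.+1 ^ 2)%:R = (m ^ 2)%:R + m.*2.+1%:R :> R.
    by rewrite -natrD; congr (_%:R); rewrite -!mulnn; lia.
  rewrite -[(u m).+1%:R]natr1 -[m.+1%:R]natr1 mulrDr.
  move: (d * _) (d * _) (\sum_(i < m) _) IH => A B S; lra.
exists (2 ^+ (j ^ 2))^-1, (C * 2 ^ (\sum_(i < j) (u i).+1))%N.
have p2 : (0:R) < 2 ^+ (j ^ 2) by rewrite exprn_gt0.
split.
- rewrite invr_gt0 p2 /= -[X in _ < X]invrK ltf_pV2 ?posrE // ?invr_gt0 //.
  apply: (lt_trans ja); rewrite -natrX ltr_nat.
  by apply: leq_ltn_trans (ltn_expl _ (isT : 1 < 2)%N); rewrite -mulnn leq_pmulr.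
- by rewrite invf_lt1 // exprn_egt1 // ?ltr1n // expn_eq0; lia.
- exists (fun i => [set x | `|2 ^+ (j ^ 2) * x - (nth 0 L i)%:~R| < 8^-1]); split.
    move=> i; apply: diam_le => [|x y /= hx hy]; first by rewrite ltW // invr_gt0.
    rewrite -[_^-1]mulr1 ler_pdivlMl // -{1}(gtr0_norm p2) -normrM mulrBr.
    move: hx hy; rewrite !ltr_norml ler_norml => /andP[h1 h2] /andP[h3 h4].
    by apply/andP; split; lra.
  move=> x /HL[p pL hp] /=.
  have pn : (index p L < C * 2 ^ (\sum_(i < j) (u i).+1))%N.
    by apply: leq_trans sL; rewrite index_mem.
  by exists (Ordinal pn) => /=; rewrite nth_index.
- by rewrite muln_gt0 C0 expn_gt0.
- have lnp n : ln (2 ^+ n : R) = n%:R * ln 2 by rewrite lnXn ?mulr_natl.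
  rewrite natrM natrX lnM ?posrE ?ltr0n ?exprn_gt0 // lnV ?posrE ?exprn_gt0 // opprK !lnp.
  have := sumu j; rewrite -natr_sum.
  have jb' : ln (C%:R : R) + ln 2 < j%:R * eta * ln 2.
    by move: jb; rewrite /b ltr_pdivrMr // -(ltr_pM2r ln2) mulrDl divfK ?gt_eqF // mul1r.
  have j1 : 1 <= j%:R :> R by rewrite ler1n.
  rewrite !natrX => hs.
  set S := (\sum_(i < j) (u i).+1)%:R in hs *.
  set l2 := ln 2 in ln2 jb' *; set lC := ln C%:R in lnC jb' *.
  set jr := j%:R in hs jb' j1 *.
  have h1 : S * l2 <= (d * jr ^+ 2 + jr) * l2 by rewrite ler_pM2r.
  have h2 : 0 <= (jr - 1) * lC by rewrite mulr_ge0 // subr_ge0.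
  have h3 : jr * (lC + l2) <= jr * (jr * eta * l2).
    by rewrite ler_wpM2l // ?ltW //; lra.
  lra.
Qed.

Lemma lower_modified_box_dim_E0 (R : realType) (d : R) u :
  (forall j, u j <= j.*2.+1)%N -> (forall j, (u j)%:R <= d * j.*2.+1%:R) ->
  (lower_modified_box_dim (E0 (fun n => (2 ^ capped_exponent u n)%N%:R : R))
    <= d%:E)%E.
Proof.
move=> hu ud.
apply: (@le_trans _ _ (ereal_sup
    (range (fun J => lower_box_dim (eventually_near_int u J : set R))))).
  apply: ereal_inf_lbound; exists (eventually_near_int u) => //; split;
    last exact: E0_sub_near_int.
  move=> J; split.
    exists 0; split=> [|n _]; first by rewrite normr0.
    rewrite mulr0; apply: le_lt_trans (dist_int_le 0 0) _.
    by rewrite subrr normr0 invr_gt0.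
  by exists J%:R; split => // M JM x [xJ _]; apply: le_trans xJ _; exact: ltW.
by apply: ge_ereal_sup => _ [J _ <-]; exact: lower_box_dim_near_int.
Qed.

(** * A mass distribution principle *)

(** Mass distribution for the image of Lebesgue measure under [psi], phrased
    through the Hoelder inverse of [psi]: the preimage of a set U lies in an
    interval of length 2 K |U|^t, so the preimages of a cover of E can cover
    [0,1) only if the sum of |U|^t is at least 1 / (2K). *)
Lemma hausdorff_measure_neq0 (R : realType) (E : set R) (psi : R -> R)
    (K t : R) :
  0 < K -> 0 <= t -> (forall a, 0 <= a < 1 -> E (psi a)) ->
  (forall a b, 0 <= a < 1 -> 0 <= b < 1 ->
     `|a - b| <= K * `|psi a - psi b| `^ t) ->
  hausdorff_measure t E <> 0%E.
Proof.
move=> K0 t0 Epsi holder H0.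
have : (((2 * K)^-1)%:E <= hausdorff_measure t E)%E; last first.
  by rewrite H0 lee_fin leNgt invr_gt0 mulr_gt0.
apply: (@le_trans _ _ (hausdorff_premeasure t 1 E)); last first.
  by apply: ereal_sup_ubound; exists 1 => //=.
apply: le_ereal_inf_tmp => _ [U [U1 EU] <-].
have dU i : diam (U i) \is a fin_num.
  by rewrite ge0_fin_numE ?diam_ge0 //; apply: le_lt_trans (U1 i) (ltry _).
have pU i : diam_pow t (U i) \is a fin_num.
  by rewrite /diam_pow; case: ifP => // _; rewrite -(fineK (dU i)) poweR_EFin.
pose rho i := K * fine (diam_pow t (U i)).
have rho0 i : 0 <= rho i by rewrite mulr_ge0 ?(ltW K0) // fine_ge0 // diam_pow_ge0.
pose V i := [set a : R | 0 <= a < 1 /\ U i (psi a)].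
have /choice[W WP] i : exists W : set (measurableTypeR R),
    [/\ measurable W, V i `<=` W & (lebesgue_measure W <= (2 * rho i)%:E)%E].
  have [->|/set0P[a [a01 Ua]]] := eqVneq (V i) set0.
    by exists set0; split=> //; rewrite measure0 lee_fin mulr_ge0.
  exists `[a - rho i, a + rho i]%classic; split=> //.
    move=> b [b01 Ub] /=; rewrite in_itv /= -ler_distlC.
    apply: le_trans (holder _ _ a01 b01) _; rewrite ler_pM2l //.
    have Ui0 : (U i == set0) = false by apply/negbTE/set0P; exists (psi a).
    rewrite /diam_pow Ui0 -(fineK (dU i)) poweR_EFin /=.
    apply: ge0_ler_powR; rewrite ?nnegrE // ?fine_ge0 ?diam_ge0 //.
    by rewrite -lee_fin fineK //; exact: le_diam.
  rewrite lebesgue_measure_itv /=; have := rho0 i.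
  by case: ifP => _ ?; rewrite -?EFinB lee_fin; lra.
have : (1%:E <= \sum_(0 <= i <oo) (2 * K)%:E * diam_pow t (U i))%E.
  apply: (@le_trans _ _
    (lebesgue_measure (`[0, 1[%classic : set (measurableTypeR R)))).
    by rewrite lebesgue_measure_itv /= lte_fin ltr01 -EFinB subr0.
  apply: (@le_trans _ _ (\sum_(0 <= i <oo) lebesgue_measure (W i))%E).
    apply: measure_sigma_subadditive => //; first by move=> i; have [] := WP i.
    move=> a /=; rewrite in_itv /= => a01; have [i _ Ui] := EU _ (Epsi a a01).
    by exists i => //; have [_ + _] := WP i; apply.
  apply: lee_nneseries => // i _; have [_ _ h] := WP i; apply: le_trans h _.
  by rewrite -(fineK (pU i)) -EFinM lee_fin /rho mulrA.
rewrite nneseriesZl; last by move=> i _; exact: diam_pow_ge0.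
have K2 : 0 < 2 * K by rewrite mulr_gt0.
by rewrite -lee_pdivrMl // mule1.
Qed.

(** * A Cantor subset of the summable set *)

(** The binary digits of a at the f_j positions allotted to block j, read as one
    integer. *)
Definition block_digit (R : realType) (f : nat -> nat) (a : R) (j : nat) : int :=
  Num.floor (2 ^+ (\sum_(i < j.+1) f i) * a)
  - 2 ^+ f j * Num.floor (2 ^+ (\sum_(i < j) f i) * a).

(** The digits of a are rewritten so that those of block j end just before
    position (j+1)^2; the positions of the block in front of them are zero. *)
Definition block_trunc (R : realType) (f : nat -> nat) (a : R) (j : nat) : R :=
  \sum_(i < j) (block_digit f a i)%:~R / 2 ^+ (i.+1 ^ 2).

Definition block_insert (R : realType) (f : nat -> nat) (a : R) : R :=
  sup (range (block_trunc f a)).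

Lemma block_digit_itv (R : realType) f (a : R) j :
  0 <= block_digit f a j <= 2 ^+ f j - 1.
Proof.
rewrite /block_digit big_ord_recr /= exprD.
rewrite [2 ^+ _ * 2 ^+ _]mulrC -mulrA; move: (2 ^+ _ * a) => x.
have p : (0:R) < 2 ^+ f j by rewrite exprn_gt0.
have /andP[h1 h2] := floor_itv x.
have le1 : 2 ^+ f j * Num.floor x <= Num.floor (2 ^+ f j * x).
  by rewrite floor_ge_int rmorphM rmorphXn /= ler_pM2l.
have le2 : Num.floor (2 ^+ f j * x) < 2 ^+ f j * (Num.floor x + 1).
  by rewrite floor_lt_int rmorphM rmorphXn /= ltr_pM2l.
by apply/andP; split; lia.
Qed.

Lemma block_trunc_int (R : realType) f (a : R) j :
  exists z : int, 2 ^+ (j ^ 2) * block_trunc f a j = z%:~R.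
Proof.
elim: j => [|j [z IH]]; first by exists 0; rewrite /block_trunc big_ord0 mulr0.
exists (2 ^+ j.*2.+1 * z + block_digit f a j).
rewrite /block_trunc big_ord_recr /= -/(block_trunc f a j) mulrDr.
rewrite [X in _ + X]mulrC divfK ?gt_eqF ?exprn_gt0 //.
have -> : (j.+1 ^ 2 = j.*2.+1 + j ^ 2)%N by rewrite -!mulnn; lia.
by rewrite exprD -mulrA IH [RHS]intrD [in RHS]intrM rmorphXn.
Qed.

(** The truncations are the left ends of nested intervals, which replaces any
    discussion of the convergence of the digit series. *)
Lemma block_trunc_nested (R : realType) f (a : R) i j :
  (forall j, f j <= j.*2)%N -> (i <= j)%N ->
  block_trunc f a i <= block_trunc f a j /\
  block_trunc f a j + 2 ^+ f j / 2 ^+ (j.+1 ^ 2) <=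
  block_trunc f a i + 2 ^+ f i / 2 ^+ (i.+1 ^ 2).
Proof.
move=> hf; elim: j => [|j IH]; first by rewrite leqn0 => /eqP ->.
rewrite leq_eqVlt => /orP[/eqP -> //|/IH[IH1 IH2]].
have -> : block_trunc f a j.+1 =
    block_trunc f a j + (block_digit f a j)%:~R / 2 ^+ (j.+1 ^ 2).
  by rewrite /block_trunc big_ord_recr.
have /andP[c0 c1] := block_digit_itv f a j.
set c := (block_digit f a j)%:~R : R.
have {}c0 : 0 <= c by rewrite ler0z.
have {}c1 : c <= 2 ^+ f j - 1.
  by move: c1; rewrite -(ler_int R) [leRHS]rmorphB [in leRHS]rmorphXn.
have p1 : (0:R) < 2 ^+ (j.+1 ^ 2) by rewrite exprn_gt0.
have -> : (j.+2 ^ 2 = j.+1 ^ 2 + j.+1.*2.+1)%N by rewrite -!mulnn; lia.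
have fj : (2 ^+ f j.+1 : R) <= 2 ^+ j.+1.*2.+1.
  by rewrite ler_eXn2l ?ltr1n //; have := hf j.+1; lia.
have p2 : (0:R) < 2 ^+ j.+1.*2.+1 by rewrite exprn_gt0.
split.
  by apply: le_trans IH1 _; rewrite lerDl divr_ge0 // ltW.
apply: le_trans IH2; rewrite -addrA lerD2l exprD invfM.
rewrite [X in _ + X]mulrCA -/c.
have le1 : 2 ^+ f j.+1 / 2 ^+ j.+1.*2.+1 <= 1 :> R by rewrite ler_pdivrMr ?mul1r.
have ip1 : 0 < (2 ^+ (j.+1 ^ 2) : R)^-1 by rewrite invr_gt0.
rewrite [X in _ + X]mulrC -mulrDl ler_pM2r //; lra.
Qed.

Lemma block_insert_itv (R : realType) f (a : R) j : (forall j, f j <= j.*2)%N ->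
  block_trunc f a j <= block_insert f a <=
  block_trunc f a j + 2 ^+ f j / 2 ^+ (j.+1 ^ 2).
Proof.
move=> hf.
have ub : ubound (range (block_trunc f a))
    (block_trunc f a j + 2 ^+ f j / 2 ^+ (j.+1 ^ 2)).
  move=> _ [i _ <-]; case: (leqP j i) => ij.
    have [_ h] := block_trunc_nested a hf ij; apply: le_trans h.
    by rewrite lerDl divr_ge0 // exprn_ge0.
  have [h _] := block_trunc_nested a hf (ltnW ij); apply: le_trans h _.
  by rewrite lerDl divr_ge0 // exprn_ge0.
apply/andP; split.
  apply: ub_le_sup; last by exists j.
  by exists (block_trunc f a j + 2 ^+ f j / 2 ^+ (j.+1 ^ 2)).
by apply: ge_sup => //; exists (block_trunc f a j); exists j.
Qed.

(** For e beyond j^2 the truncation at block j contributes an integer, and the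
    remaining tail is controlled by the nested intervals. *)
Lemma dist_int_power_block_insert (R : realType) f (a : R) j e :
  (forall j, f j <= j.*2)%N -> (j ^ 2 <= e)%N ->
  dist_int (2 ^+ e * block_insert f a) <= 2 ^+ e * (2 ^+ f j / 2 ^+ (j.+1 ^ 2)).
Proof.
move=> hf je; have [z hz] := block_trunc_int f a j.
have /andP[h1 h2] := block_insert_itv a j hf.
apply: le_trans (dist_int_le _ (2 ^+ (e - j ^ 2) * z)) _.
have -> : (2 ^+ (e - j ^ 2) * z)%:~R = 2 ^+ e * block_trunc f a j :> R.
  by rewrite intrM rmorphXn -hz mulrA -exprD subnK.
have p : (0:R) < 2 ^+ e by rewrite exprn_gt0.
rewrite -mulrBr normrM gtr0_norm // ler_pM2l // ger0_norm ?subr_ge0 //; lra.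
Qed.

(** The explicit convergent series to which the distances are compared. *)
Lemma telescope_inv_le1 (R : realType) N :
  \sum_(0 <= n < N) ((n.+1 * n.+2)%:R : R)^-1 <= 1.
Proof.
suff -> : \sum_(0 <= n < N) ((n.+1 * n.+2)%:R : R)^-1 = 1 - N.+1%:R^-1.
  by rewrite gerBl invr_ge0.
elim: N => [|N IH]; first by rewrite big_nil invr1 subrr.
rewrite big_nat_recr //= IH natrM -[N.+2%:R]natr1.
have h : (0:R) < N.+1%:R by rewrite ltr0n.
move: (N.+1%:R : R) h => x x0; field; apply/andP; split; lra.
Qed.

(** With k_j guard zeros, the distances of block j are at most 2^(C - k_j). As n
    is below (j+1)^2 there, 2^(k_j) >= (j+2)^4 makes them summable. The slack C
    absorbs the early blocks, where the guard may be longer than the free part. *)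
Lemma block_insert_Ef (R : realType) u k f C (a : R) :
  (forall j, u j <= j.*2.+1)%N -> (forall j, f j <= j.*2)%N ->
  (forall j, f j + k j <= u j + C)%N -> (forall j, j.+2 ^ 4 <= 2 ^ k j)%N ->
  Ef (fun n => (2 ^ capped_exponent u n)%N%:R : R) (block_insert f a).
Proof.
move=> hu hf fk hk.
have bound n : dist_int ((2 ^ capped_exponent u n)%N%:R * block_insert f a) <=
    2 ^+ C * ((n.+1 * n.+2)%:R : R)^-1.
  set j := Nat.sqrt n; rewrite natrX.
  apply: le_trans (@dist_int_power_block_insert _ f a j _ hf (capped_exponent_ge n hu)) _.
  rewrite mulrA ler_pdivrMr ?exprn_gt0 // mulrAC ler_pdivlMr ?ltr0n //.
  rewrite -!natrX -!natrM ler_nat -!expnD.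
  have nk : (n.+1 * n.+2 <= 2 ^ k j)%N.
    by apply: leq_trans (hk j); have := sqrt_itv n; rewrite -/j !expnS; nia.
  apply: leq_trans (leq_mul (leqnn _) nk) _; rewrite -expnD leq_exp2l //.
  have := fk j; have := hu j; rewrite /capped_exponent -/j -!mulnn; lia.
split.
  have := block_insert_itv a 0 hf; rewrite /block_trunc big_ord0 add0r.
  have -> : f 0%N = 0%N by apply/eqP; rewrite -leqn0; exact: hf 0%N.
  rewrite expr0 expr1 => /andP[-> h]; lra.
apply: le_lt_trans (ltry (2 ^+ C : R)).
apply: lime_le; first by apply: is_cvg_nneseries => n _ _; rewrite lee_fin dist_int_ge0.
apply: nearW => N; rewrite sumEFin lee_fin.
apply: le_trans (ler_sum _ (fun n _ => bound n)) _.
by rewrite -mulr_sumr ler_piMr ?exprn_ge0 // telescope_inv_le1.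
Qed.

Lemma floor_eq_dist (R : realType) (x y : R) :
  Num.floor x = Num.floor y -> `|x - y| <= 1.
Proof.
move=> xy; have /andP[] := floor_itv x; have /andP[] := floor_itv y.
rewrite xy intrD => *; rewrite ler_norml; apply/andP; split; lra.
Qed.

(** Let j be the first block where the digits of a and b differ. The agreement
    before j bounds |a - b|. The integers inserted in block j differ by at least
    1, and the zero at the beginning of block j + 1 keeps the two tails
    at most half of that unit, so no carry can cancel the difference. *)
Lemma block_insert_separation (R : realType) f (a b : R) :
  (forall j, f j <= j.*2)%N -> (forall N, exists j, N <= \sum_(i < j) f i)%N ->
  0 <= a < 1 -> 0 <= b < 1 -> a != b ->
  exists j, `|a - b| <= (2 ^+ (\sum_(i < j) f i))^-1 /\
    (2 ^+ (j.+1 ^ 2).+1)^-1 <= `|block_insert f a - block_insert f b|.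
Proof.
move=> hf Foo a01 b01 ab.
pose A (x : R) j := Num.floor (2 ^+ (\sum_(i < j) f i) * x).
have digitE x j : block_digit f x j = A x j.+1 - 2 ^+ f j * A x j by [].
have closeA j : A a j = A b j -> `|a - b| <= (2 ^+ (\sum_(i < j) f i))^-1.
  move=> /floor_eq_dist; rewrite -mulrBr normrM gtr0_norm ?exprn_gt0 //.
  by rewrite -[_^-1]mulr1 ler_pdivlMl ?exprn_gt0.
have exA : exists j, A a j != A b j.
  have [j hj] := Foo (Num.truncn (`|a - b|^-1)); exists j; apply/eqP => /closeA.
  have abp : 0 < `|a - b| by rewrite normr_gt0 subr_eq0.
  rewrite leNgt => /negP; apply.
  rewrite invf_plt ?posrE ?exprn_gt0 //; apply: lt_le_trans (truncnS_gt _) _.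
  by rewrite -natrX ler_nat; apply: leq_trans (ltn_expl _ (isT : 1 < 2)%N); rewrite ltnS.
have [[|j] hj jmin] := ex_minnP exA.
  move: hj; rewrite /A !big_ord0 expr0 !mul1r.
  have fl x : 0 <= x < 1 -> Num.floor (x : R) = 0 by move=> x01; apply/eqP; rewrite floor_eq.
  by rewrite !fl ?eqxx.
have eqA i : (i <= j)%N -> A a i = A b i.
  by move=> ij; apply/eqP; apply/negP => /negP /jmin; lia.
exists j; split; first exact/closeA/eqA.
have truncE : block_trunc f a j = block_trunc f b j.
  apply: eq_bigr => i _; rewrite !digitE !eqA //; first exact: ltnW.
have cne : block_digit f a j != block_digit f b j.
  by rewrite !digitE (eqA j) // (inj_eq (addIr _)).
have cne1 : 1 <= `|(block_digit f a j)%:~R - (block_digit f b j)%:~R : R|.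
  by rewrite -rmorphB /= -intr_norm ler1z; move: cne; lia.
have step x : block_trunc f x j.+1 =
    block_trunc f x j + (block_digit f x j)%:~R / 2 ^+ (j.+1 ^ 2).
  by rewrite /block_trunc big_ord_recr.
have /andP := block_insert_itv a j.+1 hf; have /andP := block_insert_itv b j.+1 hf.
have inv2 N : (2 ^+ N.+1 : R)^-1 = 2^-1 * (2 ^+ N)^-1 by rewrite exprS invfM.
rewrite !step truncE (inv2 (j.+1 ^ 2)%N).
have p1 : (0:R) < (2 ^+ (j.+1 ^ 2))^-1 by rewrite invr_gt0 exprn_gt0.
have tail : 2 ^+ f j.+1 / 2 ^+ (j.+2 ^ 2) <= 2^-1 * (2 ^+ (j.+1 ^ 2))^-1 :> R.
  rewrite ler_pdivrMr ?exprn_gt0 //.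
  have -> : (j.+2 ^ 2 = (j.+1 ^ 2 + j.+1.*2).+1)%N by rewrite -!mulnn; lia.
  rewrite (exprS _ (j.+1 ^ 2 + j.+1.*2)) exprD mulrACA mulVf // mul1r mulKf ?expf_neq0 //.
  by rewrite ler_eXn2l ?ltr1n.
move: tail p1 cne1.
move: (2 ^+ f j.+1 / 2 ^+ (j.+2 ^ 2) : R) ((2 ^+ (j.+1 ^ 2))^-1 : R).
move: (block_trunc f b j) ((block_digit f a j)%:~R : R) ((block_digit f b j)%:~R : R).
move: (block_insert f a) (block_insert f b).
move=> pa pb X c c' T P TP P0 cc [h1 h2] [h3 h4].
case: (ger0P (c - c')) cc => [_ cc|_ cc].
  by apply: le_trans (ler_norm _); nra.
by rewrite distrC; apply: le_trans (ler_norm _); nra.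
Qed.

(** A crude form of log n = O(sqrt n), enough to make the guards negligible. *)
Lemma up_log2_sqr n : (up_log 2 n.+2 ^ 2 <= 4 * n.+2)%N.
Proof.
have h e : (e.+1 ^ 2 <= 4 * 2 ^ e)%N.
  case: e => [|[|e]] //; elim: e => [|e IH] //.
  by move: IH; rewrite [(2 ^ e.+3)%N]expnS; move: (2 ^ e.+2)%N => P; rewrite -!mulnn; nia.
have := up_log_gtn (isT : 1 < 2)%N (isT : 1 < n.+2)%N.
have : (0 < up_log 2 n.+2)%N by rewrite up_log_gt0.
case: (up_log 2 n.+2) => [|e] // _ /= en; apply: leq_trans (h e) _.
by rewrite leq_mul2l /= ltnW.
Qed.

(** From k^2 <= 64 (j + 2) by completing a square: eta (j + 2) + 16 / eta is at
    least 8 sqrt (j + 2). *)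
Lemma guard_sublinear (R : realType) (eta : R) : 0 < eta ->
  exists2 C : R, 0 <= C & forall j, (4 * up_log 2 j.+2)%N%:R <= eta * j%:R + C.
Proof.
move=> eta0; exists (2 * eta + 16 / eta).
  by rewrite addr_ge0 ?mulr_ge0 ?invr_ge0 // ltW.
move=> j; have : ((up_log 2 j.+2 ^ 2)%N%:R : R) <= (4 * j.+2)%N%:R.
  by rewrite ler_nat up_log2_sqr.
have -> : (4 * j.+2)%N%:R = 4 * (j%:R + 2) :> R by rewrite -[j.+2]addn2 natrM natrD.
rewrite natrX natrM; move: (up_log _ _)%:R (j%:R : R) => e x h.
rewrite -subr_ge0.
have -> : eta * x + (2 * eta + 16 / eta) - 4 * e =
    (eta ^+ 2 * (x + 2) + 16 - 4 * eta * e) / eta.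
  by field; rewrite gt_eqF.
rewrite divr_ge0 ?(ltW eta0) //.
have : 0 <= (eta * e - 8) ^+ 2 by exact: sqr_ge0.
have : 0 <= eta ^+ 2 * (4 * (x + 2) - e ^+ 2) by rewrite mulr_ge0 ?sqr_ge0 // subr_ge0.
lra.
Qed.

(** The number of digits of a used before block j is d j^2 minus an error that is
    a small multiple of j^2 plus a multiple of j, whereas the separation scale
    has exponent (j+1)^2 + 1. Any t < d leaves room for the difference; the
    constant comes from the maximum of a downward parabola. *)
Lemma free_digits_growth (R : realType) (d t : R) (u f : nat -> nat) :
  0 <= t -> t < d -> (forall j, d * j.*2.+1%:R - 1 <= (u j)%:R) ->
  (forall j, u j - 4 * up_log 2 j.+2 <= f j)%N ->
  exists2 C : R, 0 <= C &
    forall j, t * (j.+1 ^ 2).+1%:R <= (\sum_(i < j) f i)%:R + C.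
Proof.
move=> t0 td du uf; have dt : 0 < d - t by lra.
have [C C0 hC] := guard_sublinear dt.
pose g := (d - t) / 2; pose B := C + 1 + 2 * t.
have g0 : 0 < g by rewrite divr_gt0.
have sumf j : (d - g) * j%:R ^+ 2 - (C + 1) * j%:R <= (\sum_(i < j) f i)%:R.
  elim: j => [|j IH]; first by rewrite big_ord0 expr0n /= !mulr0 subr0.
  rewrite big_ord_recr /= natrD.
  have fj : (u j)%:R - (4 * up_log 2 j.+2)%:R <= (f j)%:R :> R.
    by rewrite lerBlDr -natrD ler_nat; have := uf j; lia.
  have := hC j; have := du j; rewrite -addn1 -muln2 natrD natrM -[j.+1%:R]natr1.
  move: IH fj; move: (_%:R) (_%:R) (_%:R) (_%:R) (j%:R : R) => s u' k f' x.
  rewrite /g; nra.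
exists (B ^+ 2 / (4 * g) + 2 * t).
  by apply: addr_ge0; [apply: divr_ge0; [exact: sqr_ge0|lra]|lra].
move=> j; have := sumf j; rewrite -[(_ ^ 2).+1%:R]natr1 natrX -natr1.
move: (_%:R) (j%:R : R) => s x h.
have : 0 <= g * (x - B / (2 * g)) ^+ 2 by rewrite mulr_ge0 ?sqr_ge0 // ltW.
have -> : g * (x - B / (2 * g)) ^+ 2 = g * x ^+ 2 - B * x + B ^+ 2 / (4 * g).
  by field; rewrite gt_eqF.
move: (B ^+ 2 / _) h; rewrite /B /g => Z h1 h2; lra.
Qed.

(** Separation and growth combine to |a - b| <= 2^-F <= 2^D |psi a - psi b|^s,
    where F is the number of digits before the first differing block. *)
Lemma hausdorff_dim_Ef_ge (R : realType) (d : R) u : 0 < d ->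
  (forall j, u j <= j.*2.+1)%N -> (forall j, d * j.*2.+1%:R - 1 <= (u j)%:R) ->
  (d%:E <= hausdorff_dim (Ef (fun n => (2 ^ capped_exponent u n)%N%:R : R)))%E.
Proof.
move=> d0 hu du.
pose k j := (4 * up_log 2 j.+2)%N; pose f j := (u j - k j)%N.
have hf j : (f j <= j.*2)%N.
  have : (0 < up_log 2 j.+2)%N by rewrite up_log_gt0.
  by have := hu j; rewrite /f /k; lia.
have hk j : (j.+2 ^ 4 <= 2 ^ k j)%N.
  by rewrite /k mulnC expnM leq_exp2r // up_logP.
have [C fk] : exists C, forall j, (f j + k j <= u j + C)%N.
  have [C C0 kC] := guard_sublinear d0; exists (Num.truncn (C + 1)).+1 => j.
  suff : (k j <= u j + (Num.truncn (C + 1)).+1)%N by rewrite /f; lia.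
  rewrite -(ler_nat R) natrD; have := truncnS_gt (C + 1); have := kC j; have := du j.
  have -> : j.*2.+1%:R = j%:R * 2 + 1 :> R by rewrite -natr1 -muln2 natrM.
  rewrite -/(k j).
  have : 0 <= d * j%:R by rewrite mulr_ge0 // ltW.
  move: ((Num.truncn (C + 1)).+1%:R : R) ((u j)%:R : R) ((k j)%:R : R) (j%:R : R) => *; lra.
have Efpsi (a : R) : 0 <= a < 1 ->
    Ef (fun n => (2 ^ capped_exponent u n)%N%:R) (block_insert f a).
  by move=> _; exact: (block_insert_Ef a hu hf fk hk).
apply: le_ereal_inf_tmp => _ [s [s0 Hs] <-]; rewrite lee_fin leNgt; apply/negP => sd.
have growth t : 0 <= t -> t < d -> exists2 C : R, 0 <= C &
    forall j, t * (j.+1 ^ 2).+1%:R <= (\sum_(i < j) f i)%:R + C.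
  by move=> t0 td; exact: free_digits_growth td du _.
(* s may be 0, for which the growth bound is void: use an exponent above s *)
have Foo N : exists j, (N <= \sum_(i < j) f i)%N.
  have t0 : 0 < (s + d) / 2 by lra.
  have [D D0 hD] := growth _ (ltW t0) (ltac:(lra)).
  exists (Num.truncn ((N%:R + D) / ((s + d) / 2))).+1; set j := _.+1.
  rewrite -(ler_nat R) -(lerD2r D); apply: le_trans (hD j).
  rewrite -ler_pdivrMl // mulrC; apply/ltW/(lt_le_trans (truncnS_gt _)).
  by rewrite ler_nat -/j -mulnn; move: j => j; lia.
have [D D0 hD] := growth s s0 sd.
apply: (@hausdorff_measure_neq0 _ _ (block_insert f) (2 `^ D) s) Hs => //.
move=> a b a01 b01; have [->|ab] := eqVneq a b.
  by rewrite !subrr normr0 mulr_ge0 ?powR_ge0.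
have [j [h1 h2]] := block_insert_separation hf Foo a01 b01 ab.
apply: le_trans h1 _.
apply: (@le_trans _ _ (2 `^ D * (2 ^+ (j.+1 ^ 2).+1)^-1 `^ s)); last first.
  rewrite ler_pM2l ?powR_gt0 //; apply: ge0_ler_powR; rewrite ?nnegrE //.
rewrite -!powR_mulrn // -!powRN -powRrM -powRD; last by rewrite pnatr_eq0 implybT.
apply: ler_powR; first by rewrite ler1n.
have := hD j; move: (_%:R) (_%:R) => x y; lra.
Qed.

Theorem theorem2p3 (R : realType) (d : R) (hd : 0 <= d <= 1) :
  exists r : nat -> nat,
    let rR := fun n => (r n)%:R : R in
    [/\ forall n, (0 < r n)%N,
        rR n @[n --> \oo] --> +oo,
        hausdorff_dim (E0 rR) = d%:E /\
        lower_modified_box_dim (E0 rR) = d%:E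
      & hausdorff_dim (Ef rR) = d%:E /\
        lower_modified_box_dim (Ef rR) = d%:E].
Proof.
have /andP[d0 d1] := hd.
pose u j := Num.truncn (d * j.*2.+1%:R).
have du0 j : 0 <= d * j.*2.+1%:R by rewrite mulr_ge0.
have ud j : (u j)%:R <= d * j.*2.+1%:R by rewrite truncn_le.
have hu j : (u j <= j.*2.+1)%N.
  by rewrite -(ler_nat R); apply: le_trans (ud j) _; rewrite ler_piMl.
have du j : d * j.*2.+1%:R - 1 <= (u j)%:R.
  by have := truncnS_gt (d * j.*2.+1%:R); rewrite -/(u j) -natr1; lra.
exists (fun n => 2 ^ capped_exponent u n)%N => rR.
have MBle : (lower_modified_box_dim (E0 rR) <= d%:E)%E by exact: lower_modified_box_dim_E0.
have Hge : (d%:E <= hausdorff_dim (Ef rR))%E.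
  move: d0; rewrite le_eqVlt => /orP[/eqP <-|d0]; first exact: hausdorff_dim_ge0.
  exact: hausdorff_dim_Ef_ge.
have sub := @Ef_sub_E0 R rR.
have HfM := hausdorff_dim_le_lower_modified_box_dim (Ef rR).
have H0M := hausdorff_dim_le_lower_modified_box_dim (E0 rR).
have Hf0 := hausdorff_dimS sub; have Mf0 := lower_modified_box_dimS sub.
split; [by move=> n; rewrite expn_gt0|exact: capped_power_cvg|split|split];
  apply/eqP; rewrite eq_le; apply/andP; split.
- exact: le_trans MBle.
- exact: le_trans Hf0.
- by [].
- exact: le_trans (le_trans Hge Hf0) H0M.
- exact: le_trans HfM (le_trans Mf0 MBle).
- by [].
- exact: le_trans Mf0 MBle.
- exact: le_trans HfM.
Qed.
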